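(* Let $(X,\mathcal{Q},H)$ be a Diophantine space. If $\psi:(0,+\infty)\to(0,+\infty)$ is any nonincreasing function with $\mathrm{BA}_\psi\neq\emptyset$, and if $\phi:(0,+\infty)\to(0,+\infty)$ satisfies $\frac{\phi(q)}{\psi(q)}\to 0$ as $q\to+\infty$, then $\phi$ is not a Dirichlet function on $(X,\mathcal{Q},H)$.
   Context: A Diophantine space is a triple $(X,\mathcal{Q},H)$, where $X$ is a complete metric space, $\mathcal{Q}$ is a dense subset of $X$, and $H:\mathcal{Q}\to(0,+\infty)$ is a function. A function $\phi:(0,+\infty)\to(0,+\infty)$ is a Dirichlet function on $(X,\mathcal{Q},H)$ if for every $x\in X$ there exist $C_x>0$ and a sequence $(r_n)_{n\ge 1}$ in $\mathcal{Q}$ such that $r_n\to x$ and $\mathrm{dist}(x,r_n)\leq C_x\,\phi(H(r_n))$ for all $n$. For $\psi:(0,+\infty)\to(0,+\infty)$, $\mathrm{BA}_\psi$ is the set of points $x\in X$ that are badly approximable with respect to $\psi$, i.e. for which there exists $\varepsilon>0$ such that $\mathrm{dist}(r,x)\geq\varepsilon\,\psi(H(r))$ for all $r\in\mathcal{Q}$. *)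

(* Defs.v *)
From mathcomp Require Import all_boot all_order all_algebra.
From mathcomp Require Import all_classical all_reals topology normedtype.

Set Implicit Arguments.
Unset Strict Implicit.
Unset Printing Implicit Defensive.

Import Order.TTheory GRing.Theory Num.Theory.
Import numFieldNormedType.Exports.
Local Open Scope classical_set_scope.
Local Open Scope ring_scope.

(* The axiom of the library's [completeType], with [exists l, F --> l] for
   [cvg F]: the latter and [completeType] need a distinguished point of [X]. *)
Definition complete_space (X : uniformType) : Prop :=
  forall F : set_system X, ProperFilter F -> cauchy F ->
    exists l : X, F --> l.

(* A function on (0, +oo), or with values in it, is a total function to [R]
   constrained only on the relevant domain. *)
Definition pos_fun {R : realType} (f : R -> R) : Prop :=
  forall q : R, 0 < q -> 0 < f q.

(* [H] stands for a function on [Q]; its values outside [Q] are never used. *)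
Definition diophantine_space {R : realType} (X : metricType R)
    (Q : set X) (H : X -> R) : Prop :=
  [/\ complete_space X, dense Q & forall r : X, Q r -> 0 < H r].

Definition dirichlet_function {R : realType} (X : metricType R)
    (Q : set X) (H : X -> R) (phi : R -> R) : Prop :=
  forall x : X, exists (C : R) (r : nat -> X),
    [/\ 0 < C, forall n, Q (r n), r @ \oo --> x
      & forall n, mdist x (r n) <= C * phi (H (r n))].

Definition BA {R : realType} (X : metricType R)
    (Q : set X) (H : X -> R) (psi : R -> R) : set X :=
  [set x | exists eps : R, 0 < eps /\
     forall r : X, Q r -> eps * psi (H r) <= mdist r x].

(* Main.v *)
Require Import Defs.
From mathcomp Require Import all_boot all_order all_algebra.
From mathcomp Require Import all_classical all_reals topology normedtype.

(** A badly approximable point [x] rules [phi] out.  If [r n] tends to [x] with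
    [mdist x (r n) <= C * phi (H (r n))], then bad approximability gives
    [eps * psi (H (r n)) <= C * phi (H (r n))], so [phi / psi] is at least
    [eps / C] along the heights [H (r n)].  As [phi / psi] vanishes at infinity,
    these heights are bounded, say by [M] ([superlevel_bounded]).  Since [psi]
    is nonincreasing, [mdist (r n) x >= eps * psi (H (r n)) >= eps * psi M > 0],
    which contradicts the convergence of [r n] to [x]. *)

Import Order.TTheory GRing.Theory Num.Theory.
Import numFieldNormedType.Exports.
Local Open Scope classical_set_scope.
Local Open Scope ring_scope.

(** The bound is required to be positive because it serves as an argument of
    [psi], which is monotone and positive on positive arguments. *)
Lemma superlevel_bounded (R : realType) (f : R -> R) (c : R) :
  0 < c -> f q @[q --> +oo] --> 0 ->
  exists2 M : R, 0 < M & forall q, c <= f q -> q <= M.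
Proof.
move=> c0 /cvgr0_norm_lt /(_ _ c0) [M [_ fM]].
exists (Num.max M 1); first by rewrite lt_max ltr01 orbT.
move=> q cfq; rewrite leNgt; apply/negP; rewrite gt_max => /andP[/fM /= fq _].
by have := le_lt_trans (ler_norm _) fq; rewrite ltNge cfq.
Qed.

Theorem theorem2p6 (R : realType) (X : metricType R) (Q : set X) (H : X -> R)
    (psi phi : R -> R) :
  diophantine_space Q H ->
  pos_fun psi ->
  (forall p q : R, 0 < p -> p <= q -> psi q <= psi p) ->
  BA Q H psi !=set0 ->
  pos_fun phi ->
  phi q / psi q @[q --> +oo] --> 0 ->
  ~ dirichlet_function Q H phi.
Proof.
move=> [_ _ H0] psi0 psi_noninc [x [eps [eps0 xBA]]] _ ratio0.
move=> /(_ x) [C [r [C0 Qr rx xr]]].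
have [M M0 ratioM] := superlevel_bounded _ _ _ (divr_gt0 eps0 C0) ratio0.
have HM n : H (r n) <= M.
  apply: ratioM; rewrite ler_pdivlMr ?psi0 ?H0//.
  rewrite mulrAC ler_pdivrMr// [leRHS]mulrC.
  by rewrite (le_trans (xBA _ (Qr n)))// metric_sym.
have /cvg_ball/(_ _ (mulr_gt0 eps0 (psi0 _ M0))) [N _ /(_ N (leqnn N)) /=] := rx.
rewrite ballEmdist /= metric_sym ltNge => /negP; apply.
rewrite (le_trans _ (xBA _ (Qr N)))// ler_pM2l//.
by apply: psi_noninc => //; exact: H0.
Qed.
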